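(* There exist absolute constants $0<c<C$ such that for every $p=p(n)$ with $n^{-0.99}\le p\le 1-n^{-1}$, with probability tending to $1$ as $n\to\infty$ the minimum dimension $d$ such that $G=G(n,p)$ is a unit distance graph in $\mathbb{R}^d$ satisfies $$c\,\frac{n\log(1/(1-p))}{\log n}\le d\le C\,\frac{n\log(1/(1-p))}{\log n}.$$
   Context: A graph $G$ on $[n]$ is a unit distance graph in $\mathbb{R}^d$ if there are points $u_1,\dots,u_n\in\mathbb{R}^d$ (assigned to the vertices, not required to be distinct) such that $\|u_i-u_j\|_2=1$ for every pair of adjacent vertices $i,j$ (no condition is imposed on nonadjacent pairs). $G(n,p)$ denotes the binomial random graph on $[n]$ in which each pair is an edge independently with probability $p$. *)

(* Defs.v *)
From mathcomp Require Import all_boot.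
From Stdlib Require Import Reals ClassicalEpsilon.

Set Implicit Arguments.
Unset Strict Implicit.
Unset Printing Implicit Defensive.

(* A graph on [n] = 'I_n is a set E of pairs (i,j) with i < j (each unordered
   edge {i,j} is stored once, as (min,max)). *)
Definition vert_pair (n : nat) (e : 'I_n * 'I_n) : bool := (e.1 < e.2)%N.

Definition pairs (n : nat) : {set 'I_n * 'I_n} := [set e | vert_pair e].

Definition adj (n : nat) (E : {set 'I_n * 'I_n}) (i j : 'I_n) : bool :=
  ((i, j) \in E) || ((j, i) \in E).

Definition sqdist (d : nat) (x y : 'I_d -> R) : R :=
  \big[Rplus/0%R]_(k < d) ((x k - y k) ^ 2)%R.

(* G is a unit distance graph in R^d: points (not necessarily distinct) with
   Euclidean distance 1 across every edge. *)
Definition unit_distance_graph (n d : nat) (E : {set 'I_n * 'I_n}) : Prop :=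
  exists u : 'I_n -> 'I_d -> R,
    forall i j : 'I_n, adj E i j -> sqrt (sqdist (u i) (u j)) = 1%R.

Definition is_min_unit_dim (n : nat) (E : {set 'I_n * 'I_n}) (d : nat) : Prop :=
  unit_distance_graph d E /\
  (forall d' : nat, unit_distance_graph d' E -> (d <= d')%N).

Definition gnp_weight (n : nat) (p : R) (E : {set 'I_n * 'I_n}) : R :=
  \big[Rmult/1%R]_(e : 'I_n * 'I_n | vert_pair e)
     (if e \in E then p else (1 - p)%R).

Definition indicator (P : Prop) : R :=
  if excluded_middle_informative P then 1%R else 0%R.

Definition prob_gnp (n : nat) (p : R) (A : {set 'I_n * 'I_n} -> Prop) : R :=
  \big[Rplus/0%R]_(E : {set 'I_n * 'I_n} | E \subset pairs n)
     (gnp_weight p E * indicator (A E))%R.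
Arguments prob_gnp : clear implicits.

(* Main.v *)
(** Upper bound: put the colour classes of a proper k-colouring at the vertices
    of a regular simplex.  Exposing the vertices one at a time, a proper colouring
    of the first m vertices fails to extend only if the new vertex has a neighbour
    in every class; by convexity this has probability at most
    exp (- k (1-p)^(n/k)), which is tiny for k = C n log(1/(1-p)) / log n.

    Lower bound: if G is a unit distance graph in R^d, the matrix
    M_ij = 1 - |u_i - u_j|^2 is symmetric, has unit diagonal, vanishes on the edges
    of G and has rank at most d + 2.  A principal submatrix N of minimal density
    rank/size has a row basis containing at most (d+2)/n of the nonzero entries
    of N; by symmetry N is a rational function of that basis, so counting the zero
    patterns of polynomials bounds the number of possible supports of N.
    A union bound over these supports concludes, since G has to avoid the support. *)
From Stdlib Require Import ZArith Reals Lra.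

Set Implicit Arguments.
Unset Strict Implicit.
Unset Printing Implicit Defensive.

(** * Real estimates *)

Section RealEstimates.
Local Open Scope R_scope.

Lemma exp_ge_pow4 z : 0 <= z -> (z / 4) ^ 4 <= exp z.
Proof.
intros z0.
replace (exp z) with (exp (z / 4) ^ 4).
- apply pow_incr; split; [lra|].
  generalize (exp_ineq1_le (z / 4)); lra.
- simpl; rewrite Rmult_1_r, <- !exp_plus; f_equal; lra.
Qed.

Lemma exp_le_mono x y : x <= y -> exp x <= exp y.
Proof. intros [H | ->]; [apply Rlt_le, exp_increasing, H | apply Rle_refl]. Qed.

Lemma ln_le_mono x y : 0 < x -> x <= y -> ln x <= ln y.
Proof. intros x0 [H | ->]; [apply Rlt_le, ln_increasing; assumption | apply Rle_refl]. Qed.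

Lemma exists_nat_between y : 1 <= y -> exists k : nat, y <= INR k <= 2 * y.
Proof.
intros y1; destruct (archimed y) as [h1 h2]; exists (Z.to_nat (up y)).
rewrite INR_IZR_INZ, Z2Nat.id; [lra|].
apply le_IZR; lra.
Qed.

Lemma Rdiv_lt_swap a x y : 0 < a -> 0 < x -> a / x < y -> a / y < x.
Proof.
intros a0 x0 H.
assert (0 < a / x) by (apply Rdiv_lt_0_compat; lra).
apply Rmult_lt_reg_r with (y / x); [apply Rdiv_lt_0_compat; lra|].
replace (a / y * (y / x)) with (a / x) by (field; lra).
replace (x * (y / x)) with y by (field; lra).
exact H.
Qed.

Section LogBounds.
Variables (n : nat) (p : R).
Let L := ln (INR n).
Let b := ln (/ (1 - p)).
Let x := INR n * b / L.
Hypothesis nlarge : exp 64000 <= INR n.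
Hypothesis plow : Rpower (INR n) (- (99 / 100)) <= p.
Hypothesis phigh : p <= 1 - / INR n.

Lemma INR_large : 64000 <= INR n.
Proof. generalize (exp_ineq1_le 64000); lra. Qed.

Lemma ln_large : 64000 <= L.
Proof.
unfold L; rewrite <- (ln_exp 64000).
apply ln_le_mono; [apply exp_pos | exact nlarge].
Qed.

Lemma p_bounds : 0 < p < 1.
Proof.
assert (H := INR_large).
assert (0 < / INR n) by (apply Rinv_0_lt_compat; lra).
assert (0 < Rpower (INR n) (- (99 / 100))) by apply exp_pos.
lra.
Qed.

Lemma exp_neg_log : exp (- b) = 1 - p.
Proof.
assert (H := p_bounds).
unfold b; rewrite ln_Rinv by lra.
rewrite Ropp_involutive, exp_ln; lra.
Qed.

Lemma log_ge_p : p <= b.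
Proof. generalize exp_neg_log (exp_ineq1_le (- b)); lra. Qed.

Lemma log_le_ln : b <= L.
Proof.
assert (H := p_bounds); assert (Hn := INR_large).
unfold b, L; apply ln_le_mono; [apply Rinv_0_lt_compat; lra|].
rewrite <- (Rinv_inv (INR n)).
apply Rinv_le_contravar; [apply Rinv_0_lt_compat|]; lra.
Qed.

(** Since [b >= p >= n^(-99/100)], the product [n * b] is at least [n^(1/100) = exp (L / 100)]. *)
Lemma ratio_ge : exp (L / 100) / L <= x.
Proof.
assert (HL := ln_large); assert (Hn := INR_large).
unfold x; apply Rmult_le_compat_r; [apply Rlt_le, Rinv_0_lt_compat; lra|].
apply Rle_trans with (INR n * Rpower (INR n) (- (99 / 100))).
- rewrite <- (Rpower_1 (INR n)) at 1 by lra.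
  rewrite <- Rpower_plus; unfold Rpower; fold L.
  right; f_equal; lra.
- apply Rmult_le_compat_l; [lra|]; generalize log_ge_p; lra.
Qed.

(** In [(L / 800) ^ 4] one factor [(L / 800) ^ 2] is at least 6400 because [L >= 64000 = 800 * 80].
    This is where the threshold [exp 64000] on [n] comes from. *)
Lemma exp_half_ge : L * L <= 100 * exp (L / 200).
Proof.
assert (HL := ln_large).
assert (H1 : (L / 200 / 4) ^ 4 <= exp (L / 200)) by (apply exp_ge_pow4; lra).
assert (H2 : 6400 <= (L / 800) * (L / 800)) by nra.
assert (H3 : L * L / 100 <= (L / 200 / 4) ^ 4).
{ replace ((L / 200 / 4) ^ 4) with ((L / 800 * (L / 800)) * (L / 800 * (L / 800))) by field.
  replace (L * L / 100) with (6400 * (L / 800 * (L / 800))) by field.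
  apply Rmult_le_compat_r; lra. }
lra.
Qed.

Lemma ratio_large : 160 <= x.
Proof.
assert (HL := ln_large).
apply Rle_trans with (2 := ratio_ge).
apply Rmult_le_reg_r with L; [lra|].
replace (exp (L / 100) / L * L) with (exp (L / 100)) by (field; lra).
assert (H := exp_half_ge).
assert (exp (L / 200) <= exp (L / 100)) by (apply exp_le_mono; lra).
nra.
Qed.

(** For [k >= 200 x] the exponent [b n / k] is at most [L / 200]. Hence [k exp (- b n / k)] is at
    least [200 exp (L / 200) / L >= 2 L], and [n exp (- 2 L) = 1 / n]. *)
Lemma greedy_failure_small k : 200 * x <= k ->
  INR n * exp (- (k * exp (- (b * INR n / k)))) <= / INR n.
Proof.
intros Hk.
assert (HL := ln_large); assert (Hx := ratio_large); assert (Hn := INR_large).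
assert (Hr := ratio_ge).
assert (Hbn : b * INR n / k <= L / 200).
{ apply Rmult_le_reg_r with k; [lra|].
  replace (b * INR n / k * k) with (x * L) by (unfold x; field; lra).
  nra. }
assert (He : exp (- (L / 200)) <= exp (- (b * INR n / k))).
{ apply exp_le_mono; lra. }
assert (H2L : 2 * L <= k * exp (- (b * INR n / k))).
{ apply Rle_trans with (200 * (exp (L / 100) / L) * exp (- (L / 200))).
  - replace (200 * (exp (L / 100) / L) * exp (- (L / 200)))
      with (200 * exp (L / 200) / L).
    + apply Rmult_le_reg_r with L; [lra|].
      replace (200 * exp (L / 200) / L * L) with (200 * exp (L / 200)) by (field; lra).
      generalize exp_half_ge; lra.
    + replace (L / 100) with (L / 200 + L / 200) by field.
      rewrite exp_plus, exp_Ropp; field; split; [generalize (exp_pos (L / 200))|]; lra.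
  - apply Rmult_le_compat; try lra.
    + apply Rmult_le_pos; [lra|]; apply Rmult_le_pos;
        [apply Rlt_le, exp_pos | apply Rlt_le, Rinv_0_lt_compat; lra].
    + apply Rlt_le, exp_pos. }
apply Rle_trans with (INR n * exp (- (2 * L))).
- apply Rmult_le_compat_l; [lra|]; apply exp_le_mono; lra.
- right; replace (- (2 * L)) with (- L + - L) by lra.
  rewrite exp_plus, exp_Ropp; unfold L; rewrite exp_ln by lra; field; lra.
Qed.

Lemma sparse_failure_small : 2 * INR n ^ 6 * (/ INR n) ^ 10 <= / INR n.
Proof.
assert (Hn := INR_large).
replace (2 * INR n ^ 6 * (/ INR n) ^ 10) with (/ INR n * (2 * (/ INR n) ^ 3)) by (field; lra).
assert (0 < / INR n) by (apply Rinv_0_lt_compat; lra).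
assert (/ INR n <= / 2) by (apply Rinv_le_contravar; lra).
apply Rle_trans with (/ INR n * 1); [|lra].
apply Rmult_le_compat_l; [lra|]; simpl; nra.
Qed.

(** Used with [t = #|T|], [s = #|S|] and [Q] the number of unordered pairs covered by [S]. As
    [x >= 160], the factor [x / 80 + 2] is at most [x / 40], so [b s >= 40 t L]. Then [b <= L] gives
    [s >= 2 t], so [s <= 4 Q] and [b Q >= 10 t L]. *)
Lemma avoid_prob_small t s Q : 1 <= INR t ->
  INR n * INR t <= (x / 80 + 2) * INR s -> INR s <= 2 * INR Q + INR t ->
  exp (- b) ^ Q <= ((/ INR n) ^ 10) ^ t.
Proof.
intros Ht Hs HQ.
assert (HL := ln_large); assert (Hx := ratio_large); assert (Hn := INR_large).
assert (Hb := log_ge_p); assert (Hp := p_bounds); assert (HbL := log_le_ln).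
assert (Hs0 := pos_INR s); assert (HQ0 := pos_INR Q).
assert (xL : x * L = INR n * b) by (unfold x; field; lra).
assert (Hs1 : INR n * INR t <= x / 40 * INR s) by nra.
assert (Hs2 : 40 * INR t * L <= b * INR s).
{ apply Rmult_le_reg_l with (INR n); [lra|].
  replace (INR n * (40 * INR t * L)) with (40 * L * (INR n * INR t)) by ring.
  replace (INR n * (b * INR s)) with (40 * L * (x / 40 * INR s)).
  - apply Rmult_le_compat_l; lra.
  - transitivity (x * L * INR s); [field|]; rewrite xL; ring. }
assert (Hs3 : 2 * INR t <= INR s).
{ apply Rmult_le_reg_l with L; [lra|]. nra. }
assert (HQ1 : INR s <= 4 * INR Q) by lra.
assert (HbQ : 10 * INR t * L <= b * INR Q) by nra.
assert (powexp : forall y m, exp y ^ m = exp (INR m * y)).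
{ intros y m; induction m as [|m IH]; [simpl; rewrite Rmult_0_l, exp_0; reflexivity|].
  rewrite <- tech_pow_Rmult, IH, <- exp_plus, S_INR; f_equal; ring. }
rewrite <- pow_mult.
replace (/ INR n) with (exp (- L)).
- rewrite !powexp, mult_INR; apply exp_le_mono.
  replace (INR 10) with 10 by (simpl; lra). nra.
- unfold L; rewrite exp_Ropp, exp_ln; lra.
Qed.

End LogBounds.

End RealEstimates.

From mathcomp Require Import all_boot all_order all_algebra perm.
From mathcomp Require Import boolp Rstruct.
From mathcomp Require Import zify ring lra.
Require Import Defs.

Import Order.TTheory GRing.Theory Num.Theory.

(** * Sparse row bases of symmetric matrices *)

Section CoordinateProjections.
Variables (F : fieldType) (n : nat).
Local Open Scope ring_scope.

(** Rows and columns are deleted by multiplying with this coordinate projection, so that every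
    submatrix keeps the size [n] and the original indices. *)
Definition dmx (A : {set 'I_n}) : 'M[F]_n := diag_mx (\row_i (i \in A)%:R).

Lemma dmx_mulE m A (N : 'M[F]_(n, m)) i j :
  (dmx A *m N) i j = (i \in A)%:R * N i j.
Proof. by rewrite mul_diag_mx !mxE. Qed.

Lemma mul_dmxE m A (N : 'M[F]_(m, n)) i j :
  (N *m dmx A) i j = N i j * (j \in A)%:R.
Proof. by rewrite mul_mx_diag !mxE. Qed.

Lemma dmxE A i j : dmx A i j = (i == j)%:R * (i \in A)%:R.
Proof. by rewrite !mxE; case: eqP => _; rewrite ?mul1r ?mul0r. Qed.

Lemma dmxM A B : dmx A *m dmx B = dmx (A :&: B).
Proof.
apply/matrixP => i j; rewrite dmx_mulE !dmxE inE.
by case: (i \in A); rewrite ?mul1r ?mul0r ?mulr0.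
Qed.

Lemma dmx_idem A : dmx A *m dmx A = dmx A.
Proof. by rewrite dmxM setIid. Qed.

Lemma tr_dmx A : (dmx A)^T = dmx A.
Proof. exact: tr_diag_mx. Qed.

Lemma row_dmx_mul m A (N : 'M[F]_(n, m)) i :
  row i (dmx A *m N) = (i \in A)%:R *: row i N.
Proof. by apply/rowP=> j; rewrite !mxE -dmx_mulE !mxE. Qed.

Lemma dmx_subP m k (A : {set 'I_n}) (N : 'M[F]_(n, m)) (V : 'M_(k, m)) :
  reflect {in A, forall i, (row i N <= V)%MS} (dmx A *m N <= V)%MS.
Proof.
apply: (iffP row_subP) => [H i iA | H i].
  by have := H i; rewrite row_dmx_mul iA scale1r.
rewrite row_dmx_mul; case: (boolP (i \in A)) => [iA|_]; last first.
  by rewrite scale0r sub0mx.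
by rewrite scale1r H.
Qed.

Lemma mxrank_sum_leq (I : finType) (P : pred I) m k (B : I -> 'M[F]_(m, k)) :
  (\rank (\sum_(i | P i) B i)%R <= \sum_(i | P i) \rank (B i))%N.
Proof.
elim/big_rec2: _ => [|i y1 y2 _ IH]; first by rewrite mxrank0.
by apply: leq_trans (mxrank_add _ _) _; rewrite leq_add2l.
Qed.

Lemma rank_dmx_leq A : (\rank (dmx A) <= #|A|)%N.
Proof.
have -> : dmx A = \sum_(i in A) delta_mx i i.
  apply/matrixP => i j; rewrite dmxE summxE.
  case: (boolP (i \in A)) => iA.
    rewrite (bigD1 i) //= big1 ?addr0; last first.
      by move=> k /andP[_ ki]; rewrite mxE eq_sym (negPf ki).
    by rewrite mxE eqxx mulr1 eq_sym.
  rewrite mulr0 big1 // => k kA; rewrite mxE.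
  by case: eqP => // ik; rewrite ik kA in iA.
apply: leq_trans (mxrank_sum_leq _ _) _.
by rewrite -sum1_card leq_sum // => i _; rewrite mxrank_delta.
Qed.

(** The projections onto [A] and its complement sum to the identity, so neither upper bound on their
    ranks can be strict. *)
Lemma rank_dmx A : \rank (dmx A) = #|A|.
Proof.
apply/eqP; rewrite eqn_leq rank_dmx_leq /=.
have := mxrank_add (dmx A) (dmx (~: A)).
have -> : dmx A + dmx (~: A) = 1%:M.
  apply/matrixP => i j; rewrite mxE !dmxE inE !mxE.
  by case: (i \in A); rewrite ?mulr1 ?mulr0 ?addr0 ?add0r.
rewrite mxrank1 => H.
rewrite -(leq_add2r #|~: A|) cardsC card_ord.
by apply: leq_trans H _; rewrite leq_add2l rank_dmx_leq.
Qed.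

Definition free_rows m (N : 'M[F]_(n, m)) A := \rank (dmx A *m N) == #|A|.

(** The kernel of [dmx A] lies in that of [dmx A *m N], and freeness makes their ranks equal. *)
Lemma free_rowsP m (N : 'M[F]_(n, m)) A : free_rows N A ->
  forall y : 'rV_n, y *m (dmx A *m N) = 0 -> y *m dmx A = 0.
Proof.
move=> /eqP fA y /sub_kermxP hy.
have sub : (kermx (dmx A) <= kermx (dmx A *m N))%MS.
  by apply/sub_kermxP; rewrite mulmxA mulmx_ker mul0mx.
have e : (kermx (dmx A) == kermx (dmx A *m N))%MS.
  by rewrite -(mxrank_leqif_eq sub).2 !mxrank_ker fA rank_dmx.
by apply/sub_kermxP; rewrite (eqmxP e).
Qed.

Lemma free_rowsU1 m (N : 'M[F]_(n, m)) A i : free_rows N A ->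
  ~~ (row i N <= dmx A *m N)%MS -> free_rows N (i |: A).
Proof.
move=> /eqP fA Hi.
have iA : i \notin A.
  by apply: contra Hi => iA; have /dmx_subP := submx_refl (dmx A *m N); apply.
rewrite /free_rows eqn_leq cardsU1 iA -{2}fA add1n.
apply/andP; split.
  apply: leq_trans (mxrankM_maxl _ _) _.
  by rewrite rank_dmx cardsU1 iA add1n.
have /dmx_subP all_sub := submx_refl (dmx (i |: A) *m N).
have sub : (dmx A *m N <= dmx (i |: A) *m N)%MS.
  by apply/dmx_subP => j jA; apply: all_sub; rewrite inE jA orbT.
apply: rank_ltmx; rewrite ltmxE sub /=.
apply: contra Hi; apply: submx_trans.
by apply: all_sub; rewrite setU11.
Qed.

Section Greedy.
Variables (m : nat) (N : 'M[F]_(n, m)) (w : 'I_n -> nat).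
Let below t := [set i | (w i < t)%N].

(** The matroid greedy algorithm: a basis of the rows of weight below [t] is enlarged to a maximal
    free set of rows of weight below [t.+1]. The last clause survives each enlargement because the
    set only grows. *)
Lemma greedy_basis_upto t : exists R : {set 'I_n},
  [/\ R \subset below t, free_rows N R, (dmx (below t) *m N <= dmx R *m N)%MS
    & forall t', (t' <= t)%N ->
        (\rank (dmx (below t') *m N) <= #|R :&: below t'|)%N].
Proof.
elim: t => [|t [R [Rb Rf Rs Rr]]].
  have b0 : below 0 = set0 by apply/setP => i; rewrite !inE.
  exists set0; split; rewrite ?b0 ?sub0set ?submx_refl //.
    by rewrite /free_rows cards0 -leqn0 (leq_trans (mxrankM_maxl _ _)) ?rank_dmx ?cards0.
  move=> t'; rewrite leqn0 => /eqP->; rewrite b0.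
  by rewrite (leq_trans (mxrankM_maxl _ _)) ?rank_dmx ?cards0.
pose P (B : {set 'I_n}) := (B \subset below t.+1) && free_rows N B.
have PR : P R.
  rewrite /P Rf andbT; apply: subset_trans Rb _.
  by apply/subsetP => i; rewrite !inE => /ltnW.
have [B /maxsetP[/andP[Bb Bf] Bmax] RB] := maxset_exists PR.
have Bs : (dmx (below t.+1) *m N <= dmx B *m N)%MS.
  apply/dmx_subP => i ib; apply/negPn/negP => Hi.
  have PiB : P (i |: B).
    by rewrite /P free_rowsU1 // andbT subUset sub1set ib.
  have iB : i \in B by rewrite -(Bmax _ PiB (subsetUr _ _)) setU11.
  by case/negP: Hi; have /dmx_subP := submx_refl (dmx B *m N); apply.
exists B; split=> // t'; rewrite leq_eqVlt => /orP[/eqP->|lt].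
  rewrite (setIidPl Bb); apply: leq_trans (mxrankS Bs) _.
  by apply: leq_trans (mxrankM_maxl _ _) _; rewrite rank_dmx.
by apply: leq_trans (Rr _ lt) _; rewrite subset_leq_card // setSI.
Qed.

Lemma greedy_basis : exists R : {set 'I_n},
  [/\ free_rows N R, (N <= dmx R *m N)%MS
    & forall t, (\rank (dmx (below t) *m N) <= #|R :&: below t|)%N].
Proof.
have [R [_ Rf Rs Rr]] := greedy_basis_upto (\max_i w i).+1.
have bT s : (\max_i w i < s)%N -> below s = setT.
  move=> hs; apply/setP => i; rewrite !inE; apply: leq_ltn_trans hs.
  exact: (leq_bigmax i).
exists R; split=> //.
  apply: submx_trans Rs; apply/row_subP => i.
  have /dmx_subP := submx_refl (dmx (below (\max_i w i).+1) *m N).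
  by apply; rewrite bT // inE.
move=> t; have [le|lt] := leqP t (\max_i w i).+1; first exact: Rr.
by rewrite (bT t) ?(ltnW lt) // -(bT (\max_i w i).+1) //; apply: Rr.
Qed.
End Greedy.

End CoordinateProjections.

Lemma sum_ord_ltn b k : (\sum_(t < b) (t < k) = minn b k)%N.
Proof. by elim: b => [|b IH]; rewrite ?big_ord0 ?big_ord_recr /= ?IH; lia. Qed.

(** Layer-cake summation: [w i] is the number of thresholds [t < b] with [t < w i]. *)
Lemma sum_layers n (A : {set 'I_n}) (w : 'I_n -> nat) b :
  (forall i, w i <= b)%N ->
  (\sum_(i in A) w i = \sum_(t < b) #|A :\: [set i | w i < t.+1]|)%N.
Proof.
move=> wb.
have -> : (\sum_(i in A) w i = \sum_(i in A) \sum_(t < b) (t < w i))%N.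
  by apply: eq_bigr => i _; rewrite sum_ord_ltn (minn_idPr (wb i)).
rewrite exchange_big; apply: eq_bigr => t _ /=.
rewrite -sum1_card big_mkcond [RHS]big_mkcond /=; apply: eq_bigr => i _.
by rewrite !inE ltnS -ltnNge; case: (i \in A); case: (_ < _)%N.
Qed.

Lemma card_pairs_set (I J : finType) (A : {set I}) (P : I -> J -> bool) :
  (#|[set e : I * J | (e.1 \in A) && P e.1 e.2]| = \sum_(i in A) #|[set j | P i j]|)%N.
Proof.
rewrite -sum1_card.
under [RHS]eq_bigr do rewrite -sum1_card.
rewrite pair_big_dep /=; apply: eq_bigl => -[i j] /=.
by rewrite !inE.
Qed.

Section SparseCore.
Variables (F : fieldType) (n : nat) (M : 'M[F]_n).
Local Open Scope ring_scope.

Definition restrict (U : {set 'I_n}) : 'M[F]_n := dmx F U *m M *m dmx F U.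

Lemma restrictE U i j : restrict U i j = (i \in U)%:R * M i j * (j \in U)%:R.
Proof. by rewrite mul_dmxE dmx_mulE. Qed.

(** Exhibits the smaller principal submatrix as a product starting with the rows [W] of
    [restrict U], whose rank therefore bounds its rank. *)
Lemma restrict_restrict U W :
  dmx F W *m restrict U *m dmx F (U :&: W) = restrict (U :&: W).
Proof.
rewrite /restrict !mulmxA dmxM setIC -!mulmxA dmxM.
by rewrite setIA setIid.
Qed.

(** A nonempty set minimising the quotient of rank by size. Cross-multiplying lets the inequality
    hold for empty [W] as well. *)
Lemma exists_min_density : (0 < n)%N -> exists U : {set 'I_n}, U != set0 /\
  forall W : {set 'I_n},
    (\rank (restrict U) * #|W| <= \rank (restrict W) * #|U|)%N.
Proof.
move=> n0.
pose d (W : {set 'I_n}) : rat := (\rank (restrict W))%:R / #|W|%:R.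
have T0 : [set: 'I_n] != set0 by rewrite -card_gt0 cardsT card_ord.
case: (@arg_minP _ _ _ setT (fun W => W != set0) d T0) => U U0 Umin; exists U; split => // W.
have [->|W0] := eqVneq W set0; first by rewrite cards0 muln0.
have := Umin _ W0; rewrite /d.
rewrite ler_pdivrMr ?ltr0n ?card_gt0 // mulrAC ler_pdivlMr ?ltr0n ?card_gt0 //.
by rewrite -!natrM ler_nat.
Qed.

(* Minimality of the density [rank / size] makes every set of rows of the core
   have rank at least its share, so that the greedy basis, taking the sparsest
   rows first, contains at most its share of the nonzero entries. *)
Lemma sparse_core : (0 < n)%N -> (forall i, M i i != 0) ->
  exists (U R : {set 'I_n}),
  let N := restrict U in
  let T := [set e : 'I_n * 'I_n | (e.1 \in R) && (N e.1 e.2 != 0)] in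
  let S := [set e : 'I_n * 'I_n | N e.1 e.2 != 0] in
  [/\ free_rows N R, (N <= dmx F R *m N)%MS, T != set0,
      (#|[set i | N i i != 0%R]| <= #|T|)%N & (n * #|T| <= \rank M * #|S|)%N].
Proof.
move=> n0 Mdiag.
have [U [U0 Umin]] := exists_min_density n0.
pose N := restrict U.
pose w i := #|[set j | N i j != 0]|.
have [R [Rfree Rspan Rrank]] := greedy_basis N w.
exists U, R => /=; rewrite -/N.
set T := [set e | (_ \in R) && _]; set S := [set e : 'I_n * 'I_n | N e.1 e.2 != 0].
have Ndiag i : (N i i != 0) = (i \in U).
  by rewrite restrictE; case: (i \in U); rewrite !(mul0r, mul1r, mulr1) ?Mdiag ?eqxx.
have dU : [set i | N i i != 0] = U by apply/setP => i; rewrite inE Ndiag.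
(* Column [i] of [N] has the nonzero entry [N i i]. The rows in [R] span all rows, so one of them is
   nonzero in column [i]. *)
have UT : U \subset [set e.2 | e in T].
  apply/subsetP => i iU; have [Q NQ] := submxP Rspan.
  have := iU; rewrite -Ndiag NQ mxE.
  have [a Ha|none] := pickP [pred a | (a \in R) && (N a i != 0)].
    by move=> _; apply/imsetP; exists (a, i) => //; rewrite inE.
  rewrite big1 ?eqxx // => a _; rewrite dmx_mulE.
  have := none a; rewrite inE; case: (a \in R) => /=; last by rewrite mul0r mulr0.
  by move/negbFE/eqP->; rewrite !mulr0.
have UleT : (#|U| <= #|T|)%N.
  by apply: leq_trans (subset_leq_card UT) _; apply: leq_imset_card.
split => //; first by rewrite -card_gt0 (leq_trans _ UleT) ?card_gt0.
  by rewrite dU.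
have wn i : (w i <= n)%N by rewrite -[n in leqRHS]card_ord max_card.
have cT : #|T| = (\sum_(i in R) w i)%N by rewrite /T (card_pairs_set R (fun i j => N i j != 0)).
have cS : #|S| = (\sum_(i in U) w i)%N.
  rewrite -(card_pairs_set U (fun i j => N i j != 0)); congr #|pred_of_set _|.
  apply/setP => -[i j]; rewrite !inE /=; case: (boolP (i \in U)) => //= iU.
  by rewrite restrictE (negPf iU) !mul0r eqxx.
(* With [B] the rows of weight below [t], minimality gives [\rank N * #|U :&: B| <= #|R :&: B| *
   #|U|]. Subtracting this from [#|U| * #|R| <= \rank N * #|U|] leaves the claim for the heavy
   rows. *)
have layer t : (#|U| * #|R :\: [set i | (w i < t)%N]|
                <= \rank N * #|U :\: [set i | (w i < t)%N]|)%N.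
  set B := [set i | _].
  have RN : (#|R| <= \rank N)%N by rewrite -(eqP Rfree) mxrankM_maxr.
  have BW : (\rank (restrict (U :&: B)) <= #|R :&: B|)%N.
    apply: leq_trans (Rrank t); rewrite -restrict_restrict.
    exact: mxrankM_maxl.
  have HW := Umin (U :&: B).
  have := cardsID B R; have := cardsID B U; rewrite -/N in HW.
  move: RN BW HW; move: (\rank _) (\rank _) #|_| #|_| #|_| #|_| #|_| #|_|.
  nia.
have mT : (#|U| * #|T| <= \rank N * #|S|)%N.
  rewrite cT cS (sum_layers _ wn) (sum_layers _ wn) !big_distrr /=.
  by apply: leq_sum => t _.
(* Comparison with the full index set replaces the density of [N] by that of [M], which is
   [\rank M / n]. *)
have := Umin setT.
have -> : restrict setT = M.
  by apply/matrixP => i j; rewrite restrictE !inE mul1r mulr1.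
rewrite cardsT card_ord => kn.
have Upos : (0 < #|U|)%N by rewrite card_gt0.
rewrite -(leq_pmul2l Upos).
have := leq_mul mT (leqnn n); have := leq_mul kn (leqnn #|S|); rewrite -/N.
move: (\rank _) (\rank _) #|_| #|_| #|_| => a b c e f; nia.
Qed.
End SparseCore.

(** * Recovering a symmetric matrix from a row basis *)

Section SymmetricFactorisation.
Variables (F : fieldType) (n : nat) (N : 'M[F]_n) (R : {set 'I_n}).
Local Open Scope ring_scope.
Let X := dmx F R *m N.

(** For [X = dmx R *m N] this is the principal [R]-block of [N], completed by the identity on the
    complement so that invertibility of the block becomes invertibility of an [n] by [n] matrix. *)
Definition bordered (X : 'M[F]_n) := X *m dmx F R + dmx F (~: R).

(** By symmetry the columns in [R] span all columns as well. A row vector killing the [R]-block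
    therefore kills all of [X], and freeness makes the block invertible. Writing [N = P X] then
    gives [X^T = P D A], and [P] can be eliminated. *)
Lemma symmetric_factorisation : N^T = N -> free_rows N R -> (N <= X)%MS ->
  bordered X \in unitmx /\ N = X^T *m invmx (bordered X) *m X.
Proof.
move=> Nsym Rfree /submxP[P NP].
have NP' : N = N *m dmx F R *m P^T.
  by rewrite -{1}Nsym {1}NP trmx_mul /X trmx_mul tr_dmx Nsym.
set A := bordered X; pose D := dmx F R; pose D' := dmx F (~: R).
have DD' : D *m D' = 0.
  rewrite /D /D' dmxM setICr; apply/matrixP => i j.
  by rewrite dmxE inE mulr0 mxE.
have D'D : D' *m D = 0.
  rewrite /D /D' dmxM setIC setICr; apply/matrixP => i j.
  by rewrite dmxE inE mulr0 mxE.
have D1 : D + D' = 1%:M.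
  apply/matrixP => i j; rewrite mxE !dmxE inE !mxE.
  by case: (i \in R); rewrite ?mulr1 ?mulr0 ?addr0 ?add0r.
have AD : A *m D = X *m D.
  by rewrite /A /bordered -/D -/D' mulmxDl D'D addr0 -mulmxA dmx_idem.
have DA : D *m A = X *m D.
  by rewrite /A /bordered -/D -/D' mulmxDr DD' addr0 /X !mulmxA dmx_idem.
have uA : A \in unitmx.
  rewrite -row_free_unit; apply: inj_row_free => y yA.
  have yD' : y *m D' = 0.
    have : y *m A *m D' = 0 by rewrite yA mul0mx.
    rewrite -mulmxA /A /bordered -/D -/D' mulmxDl -mulmxA DD' mulmx0 add0r.
    by rewrite dmx_idem.
  have yD : y *m D = 0.
    apply: (free_rowsP Rfree); rewrite {1}NP'.
    have e : y *m A *m D *m P^T = 0 by rewrite yA !mul0mx.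
    by rewrite -[RHS]e -[y *m A *m D]mulmxA AD /X !mulmxA.
  by rewrite -[y]mulmx1 -D1 mulmxDr yD yD' addr0.
split => //.
have e1 : X^T = P *m D *m A.
  by rewrite -[P *m D *m A]mulmxA DA mulmxA -NP /X trmx_mul tr_dmx Nsym.
rewrite e1 -[P *m D *m A *m _]mulmxA mulmxV // mulmx1.
by rewrite -mulmxA /X [D *m (_ *m _)]mulmxA dmx_idem.
Qed.
End SymmetricFactorisation.

(** * Counting zero patterns *)

Section ZeroPatterns.
Variables (F : fieldType) (V : finType).
Local Open Scope ring_scope.
Implicit Types (f g : (V -> F) -> F) (x : V -> F).

(** Polynomial functions of degree at most [D] in each variable separately; they are spanned by
    [(D + 1) ^ #|V|] monomials, which is the dimension used in the count. *)
Definition polyfun D f := exists s : seq (F * {ffun V -> nat}),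
  (forall t, t \in s -> forall v, (t.2 v <= D)%N) /\
  (forall x, f x = \sum_(t <- s) t.1 * \prod_v x v ^+ t.2 v).

Lemma polyfun_ext D f g : f =1 g -> polyfun D f -> polyfun D g.
Proof. by move=> fg [s [sD sf]]; exists s; split=> // x; rewrite -fg. Qed.

Lemma polyfun_weaken D D' f : (D <= D')%N -> polyfun D f -> polyfun D' f.
Proof.
move=> DD' [s [sD sf]]; exists s; split=> // t ts v.
exact: leq_trans (sD t ts v) DD'.
Qed.

Lemma polyfun_cst D a : polyfun D (fun=> a).
Proof.
exists [:: (a, [ffun=> 0%N])]; split=> [t|x].
  by rewrite inE => /eqP-> v; rewrite ffunE.
by rewrite big_seq1 /= big1 ?mulr1 // => v _; rewrite ffunE expr0.
Qed.

Lemma polyfun_var D v : polyfun D.+1 (fun x => x v).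
Proof.
exists [:: (1, [ffun u => (u == v) : nat])]; split=> [t|x].
  by rewrite inE => /eqP-> u; rewrite ffunE; case: eqP.
rewrite big_seq1 /= mul1r (bigD1 v) //= ffunE eqxx expr1 big1 ?mulr1 //.
by move=> u uv; rewrite ffunE (negPf uv) expr0.
Qed.

Lemma polyfunD D f g : polyfun D f -> polyfun D g -> polyfun D (fun x => f x + g x).
Proof.
move=> [s [sD sf]] [s' [sD' sf']]; exists (s ++ s'); split=> [t|x].
  by rewrite mem_cat => /orP[]; [apply: sD | apply: sD'].
by rewrite big_cat /= sf sf'.
Qed.

Lemma polyfunM D D' f g :
  polyfun D f -> polyfun D' g -> polyfun (D + D') (fun x => f x * g x).
Proof.
move=> [s [sD sf]] [s' [sD' sf']].
pose m (t t' : F * {ffun V -> nat}) : F * {ffun V -> nat} :=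
  (t.1 * t'.1, [ffun v => t.2 v + t'.2 v]%N).
exists [seq m t t' | t <- s, t' <- s'].
split=> [_ /allpairsP[[t t'] [/= ts ts' ->]] v|x].
  by rewrite ffunE leq_add ?sD ?sD'.
rewrite big_allpairs_dep sf sf' big_distrl /=; apply: eq_bigr => t _.
rewrite big_distrr /=; apply: eq_bigr => t' _.
rewrite mulrACA -big_split /=; congr (_ * _).
by apply: eq_bigr => v _; rewrite ffunE exprD.
Qed.

Lemma polyfun_sum D (J : Type) (r : seq J) (P : pred J) (f : J -> (V -> F) -> F) :
  (forall j, P j -> polyfun D (f j)) ->
  polyfun D (fun x => \sum_(j <- r | P j) f j x).
Proof.
move=> fD; elim: r => [|j r IH].
  by apply: polyfun_ext (polyfun_cst D 0) => x; rewrite big_nil.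
case Pj: (P j); last by apply: polyfun_ext IH => x; rewrite big_cons Pj.
by apply: polyfun_ext (polyfunD (fD j Pj) IH) => x; rewrite big_cons Pj.
Qed.

Lemma polyfun_prod D (J : finType) (P : pred J) (f : J -> (V -> F) -> F) :
  (forall j, P j -> polyfun D (f j)) ->
  polyfun (#|P| * D) (fun x => \prod_(j | P j) f j x).
Proof.
move=> fD.
have -> : #|P| = size (enum P) by rewrite cardE.
apply: (@polyfun_ext _ (fun x => \prod_(j <- enum P) f j x)).
  by move=> x; rewrite big_enum.
have : {subset enum P <= P} by move=> j; rewrite mem_enum.
elim: (enum P) => [|j r IH] rP /=.
  by apply: polyfun_ext (polyfun_cst _ 1) => x; rewrite big_nil.
have Pj : P j by apply: rP; rewrite mem_head.
rewrite mulSn.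
apply: polyfun_ext (polyfunM (fD j Pj) (IH _)) => [x|i ir].
  by rewrite big_cons.
by apply: rP; rewrite inE ir orbT.
Qed.

Lemma polyfun_span D f : polyfun D f ->
  exists c : {ffun V -> 'I_D.+1} -> F,
    forall x, f x = \sum_e c e * \prod_v x v ^+ e v.
Proof.
move=> [s [sD sf]].
pose tr (t : F * {ffun V -> nat}) : {ffun V -> 'I_D.+1} :=
  [ffun v => inord (t.2 v)].
exists (fun e => \sum_(t <- s | tr t == e) t.1) => x.
rewrite sf; under [RHS]eq_bigr do rewrite big_distrl /=.
rewrite (exchange_big_dep predT) //= big_seq [RHS]big_seq.
apply: eq_bigr => t ts; rewrite (big_pred1 (tr t)); last by move=> e; rewrite eq_sym.
by congr (_ * _); apply: eq_bigr => v _; rewrite ffunE inordK // ltnS sD.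
Qed.

(* For each pattern [S] take a point [x S] realising it and the product [g S] of
   the functions in [S]: as [g S (x T) != 0] iff [S \subset T], the [g S] are
   linearly independent. *)
Lemma card_zero_patterns D (I : finType) (f : I -> (V -> F) -> F)
    (P : {set {set I}}) :
  (forall i, polyfun D (f i)) ->
  (forall S, S \in P -> exists x, S = [set i | f i x != 0]) ->
  (#|P| <= (#|I| * D).+1 ^ #|V|)%N.
Proof.
move=> fD Px.
have chx S : exists x, S \in P -> S = [set i | f i x != 0].
  have [SP|_] := boolP (S \in P); last by exists (fun=> 0).
  by have [x xS] := Px _ SP; exists x.
pose x S := sval (cid (chx S)).
have xP S : S \in P -> S = [set i | f i (x S) != 0].
  by rewrite /x; case: cid.
pose g (S : {set I}) y := \prod_(i in S) f i y.
have gD S : polyfun (#|I| * D) (g S).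
  apply: (@polyfun_weaken (#|S| * D)); first by rewrite leq_mul2r max_card orbT.
  by apply: polyfun_prod => i _.
pose c S := sval (cid (polyfun_span (gD S))).
have cP S y : g S y = \sum_e c S e * \prod_v y v ^+ e v.
  by rewrite /c; case: cid.
have gx S T : T \in P -> (g S (x T) != 0) = (S \subset T).
  move=> TP; rewrite /g prodf_seq_neq0.
  have TE i : (i \in T) = (f i (x T) != 0) by rewrite {1}(xP T TP) inE.
  apply/allP/subsetP => H i.
    by move=> iS; have := H i (mem_index_enum i); rewrite iS TE.
  by move=> _; apply/implyP => /H; rewrite TE.
pose G := \matrix_(a < #|P|, b < #|P|) g (enum_val a) (x (enum_val b)).
pose E : finType := {ffun V -> 'I_(#|I| * D).+1}.
pose C := \matrix_(a < #|P|, e < #|E|) c (enum_val a) (enum_val e).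
pose Y := \matrix_(e < #|E|, b < #|P|)
   \prod_v x (enum_val b) v ^+ (enum_val e : E) v.
have GE : G = C *m Y.
  apply/matrixP => a b; rewrite !mxE cP (reindex (enum_val : 'I_#|E| -> E)) /=; last first.
    exact: onW_bij (enum_val_bij E).
  by apply: eq_bigr => e _; rewrite !mxE.
(* In a vanishing combination choose a set [b] of least size with nonzero coefficient and evaluate
   at its point. Another surviving term would come from a subset of [b] at least as large as [b],
   hence from [b] itself. *)
have Gfree : row_free G.
  apply: inj_row_free => u uG; apply/eqP/negPn/negP => u0.
  have [a ua] : exists a, u 0 a != 0.
    apply/existsP; rewrite -negb_forall; apply: contra u0 => /forallP u0.
    by apply/eqP/rowP => a; rewrite mxE; apply/eqP.
  case: (@arg_minnP _ a (fun a => u 0 a != 0) (fun a => #|enum_val a|) ua) => b ub bmin.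
  have := congr1 (fun A : 'rV_ _ => A 0 b) uG; rewrite !mxE (bigD1 b) //= big1.
    move/eqP; rewrite addr0 mulf_eq0 (negPf ub) /= mxE; apply/negP.
    by rewrite gx ?enum_valP.
  move=> a' ab; rewrite mxE; have [-> //|ua'] := eqVneq (u 0 a') 0; first by rewrite mul0r.
  apply/eqP; rewrite mulf_eq0; apply/orP; right; apply/negPn; rewrite gx ?enum_valP //.
  apply: contra ab => sub; apply/eqP/enum_val_inj/eqP.
  by rewrite eqEcard sub bmin.
rewrite -(eqP Gfree) GE; apply: leq_trans (mxrankM_maxl _ _) _.
by apply: leq_trans (rank_leq_col _) _; rewrite card_ffun card_ord.
Qed.

End ZeroPatterns.

(** * Supports determined by a sparse row basis *)

Section RealisablePatterns.
Variables (F : fieldType) (n : nat).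
Local Open Scope ring_scope.
Implicit Types T S : {set 'I_n * 'I_n}.

Definition point T : Type := {e | e \in T} -> F.

Definition gather T (x : point T) : 'M[F]_n :=
  \matrix_(a, j) if insub (a, j) is Some t then x t else 0.

(* [X^T A^-1 X] cleared of its denominator, so that its entries are polynomials in
   the free entries [x] of the basis rows. *)
Definition symform T (x : point T) : 'M[F]_n :=
  let X := gather x in
  X^T *m \adj (bordered [set e.1 | e in T] X) *m X.

Definition realisable T : {set {set 'I_n * 'I_n}} :=
  [set S | `[< exists x : point T,
                 S = [set e | symform x e.1 e.2 != 0] >]].

Lemma polyfun_gather T a j : polyfun 1 (fun x : point T => gather x a j).
Proof.
case E: (insub (a, j) : option {e | e \in T}) => [t|].
  by apply: polyfun_ext (polyfun_var F 0 t) => x; rewrite mxE E.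
by apply: polyfun_ext (polyfun_cst _ 1 0) => x; rewrite mxE E.
Qed.

(** Each outer factor [X] has degree 1, and an entry of the adjugate is a signed minor, a sum of
    products of [n - 1] affine entries. *)
Lemma polyfun_symform T i j :
  polyfun (1 + n.-1 + 1) (fun x : point T => symform x i j).
Proof.
set R := [set e.1 | e in T].
pose X (x : point T) := gather x.
refine (@polyfun_ext _ _ _ (fun x => \sum_(b < n) (\sum_(a < n) X x a i *
   ((-1) ^+ (b + a) * \sum_(s : 'S_n.-1) (-1) ^+ s *
      \prod_(k | true) bordered R (X x) (lift b k) (lift a (s k)))) * X x b j) _ _ _).
  move=> x; rewrite /symform -/R -/(X x) [in RHS]mxE; apply: eq_bigr => b _.
  congr (_ * _); rewrite [in RHS]mxE; apply: eq_bigr => a _; rewrite [in RHS]mxE.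
  congr (_ * _); rewrite [in RHS]mxE /cofactor; congr (_ * _).
  apply: eq_bigr => s _; congr (_ * _); apply: eq_bigr => k _.
  by rewrite [in RHS]mxE [in RHS]mxE.
apply: polyfun_sum => b _; apply: polyfunM; last exact: polyfun_gather.
apply: polyfun_sum => a _; apply: polyfunM; first exact: polyfun_gather.
apply: (@polyfunM _ _ 0 n.-1); first exact: polyfun_cst.
apply: polyfun_sum => s _; apply: (@polyfunM _ _ 0 n.-1).
  exact: polyfun_cst.
apply: (@polyfun_weaken _ _ (#|(fun=> true) : pred 'I_n.-1| * 1)).
  by rewrite muln1 -[leqRHS]card_ord max_card.
apply: polyfun_prod => k _.
set c := lift b k; set d := lift a _.
apply: (@polyfun_ext _ _ _ (fun x => X x c d * (d \in R)%:R + dmx F (~: R) c d)).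
  by move=> x; rewrite [RHS]mxE mul_dmxE.
apply: polyfunD; last exact: polyfun_cst.
by apply: (@polyfunM _ _ 1 0); [apply: polyfun_gather | apply: polyfun_cst].
Qed.

(** There are [n ^ 2] entries of degree at most [n + 1] in [#|T|] variables, and
    [n ^ 2 * (n + 1) + 1 <= n ^ 4] for [n >= 2]. *)
Lemma card_realisable T : (1 < n)%N -> (#|realisable T| <= n ^ (4 * #|T|))%N.
Proof.
move=> n1.
pose f (e : 'I_n * 'I_n) (x : point T) := symform x e.1 e.2.
have fD e : polyfun (1 + n.-1 + 1) (f e) by apply: polyfun_symform.
apply: leq_trans (card_zero_patterns fD _) _.
  by move=> S; rewrite inE => /asboolP[x ->]; exists x.
rewrite card_prod card_ord card_sig expnM.
case: #|T| => // k; rewrite leq_exp2r //.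
by case: n n1 => [|[|m]] // _; rewrite !expnS expn0 muln1 /=; nia.
Qed.

Lemma sparse_realisable_pattern (M : 'M[F]_n) :
  (0 < n)%N -> M^T = M -> (forall i, M i i != 0) ->
  exists T S, [/\ T != set0, S \in realisable T,
    (#|[set i | (i, i) \in S]| <= #|T|)%N, (n * #|T| <= \rank M * #|S|)%N
    & forall e, e \in S -> M e.1 e.2 != 0].
Proof.
move=> n0 Msym Mdiag.
have [U [R /=]] := sparse_core n0 Mdiag.
set N := restrict M U.
set T := [set e | (_ \in R) && _]; set S := [set e : 'I_n * 'I_n | N e.1 e.2 != 0].
move=> [Rfree Rspan T0 Tdiag TS].
exists T, S; split => //; last 2 first.
- by apply: leq_trans Tdiag; rewrite subset_leq_card //; apply/subsetP => i; rewrite !inE.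
- by move=> e; rewrite inE restrictE; apply: contraNneq => ->; rewrite mulr0 mul0r.
have Nsym : N^T = N.
  by rewrite /N /restrict !trmx_mul !tr_dmx Msym mulmxA.
have [uA NE] := symmetric_factorisation Nsym Rfree Rspan.
pose x (t : {e | e \in T}) := N (val t).1 (val t).2.
have gE : gather x = dmx F R *m N.
  apply/matrixP => a j; rewrite mxE dmx_mulE.
  case: insubP => [t _ tE|]; last first.
    rewrite inE /=; case: (a \in R) => /=; last by rewrite mul0r.
    by move/negbNE/eqP->; rewrite mulr0.
  have := valP t; rewrite /x tE inE /= => /andP[-> _].
  by rewrite mul1r.
(* No row of the basis vanishes, by freeness, so [R] can be read off from [T]. *)
have TR : [set e.1 | e in T] = R.
  apply/setP => a; apply/imsetP/idP => [[e eT ->]|aR].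
    by move: eT; rewrite inE => /andP[].
  have [j Haj|none] := pickP [pred j | N a j != 0].
    by exists (a, j) => //; rewrite inE aR.
  have : (delta_mx 0 a : 'rV_n) *m (dmx F R *m N) = 0.
    rewrite -rowE row_dmx_mul; have -> : row a N = 0; last by rewrite scaler0.
    apply/rowP => j; rewrite [RHS]mxE [LHS]mxE.
    exact/eqP/negbFE/(none j).
  move/(free_rowsP Rfree)/rowP/(_ a)/eqP; rewrite mul_dmxE !mxE aR !eqxx mulr1.
  by rewrite oner_eq0.
rewrite inE; apply/asboolP; exists x.
move: uA NE gE; set X := dmx F R *m N; set A := bordered R X => uA NE gE.
(* Clearing the denominator only scales [N] by a nonzero determinant, so the support is
   unchanged. *)
have -> : symform x = \det A *: N.
  rewrite /symform TR gE -/A [in RHS]NE /invmx uA -scalemxAr -scalemxAl scalerA.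
  by rewrite mulfV ?scale1r // -unitfE -unitmxE.
apply/setP => e; rewrite !inE [in RHS]mxE mulf_eq0.
suff /negPf-> : \det A != 0 by [].
by rewrite -unitfE -unitmxE.
Qed.

End RealisablePatterns.

(** * The binomial random graph *)

Section RandomSubset.
Variables (K : realFieldType) (X : finType) (p : K).
Local Open Scope ring_scope.
Implicit Types (l : seq X) (f g : {set X} -> K).

(** The expectation over a random subset of [l], defined by revealing its elements in order;
    splitting the list is then conditioning on the part already revealed. *)
Fixpoint expect l f : K :=
  if l is x :: l' then
    p * expect l' (fun E => f (x |: E)) + (1 - p) * expect l' f
  else f set0.

Lemma eq_expect l f g : f =1 g -> expect l f = expect l g.
Proof.
elim: l f g => [|x l IH] f g fg /=; first exact: fg.
by congr (_ * _ + _ * _); apply: IH => // E; apply: fg.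
Qed.

Lemma expect_cat l1 l2 f :
  expect (l1 ++ l2) f = expect l1 (fun E1 => expect l2 (fun E2 => f (E1 :|: E2))).
Proof.
elim: l1 f => [|x l1 IH] f /=; first by apply: eq_expect => E; rewrite set0U.
rewrite !IH; congr (_ * _ + _).
by apply: eq_expect => E1; apply: eq_expect => E2; rewrite setUA.
Qed.

Lemma expect_sumE l f : uniq l ->
  expect l f = \sum_(E : {set X} | E \subset [set x in l])
     (\prod_(x <- l) (if x \in E then p else 1 - p)) * f E.
Proof.
elim: l f => [|x l IH] f /=.
  move=> _; rewrite (big_pred1 set0) ?big_nil ?mul1r // => E.
  by rewrite /= -subset0; congr (_ \subset _); apply/setP => x; rewrite !inE.
move=> /andP[xl ul]; rewrite !IH // [RHS](bigID (fun E : {set X} => x \in E)) /=.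
have xE (E : {set X}) : E \subset [set y in l] -> x \notin E.
  by move=> /subsetP El; apply/negP => /El; rewrite inE (negPf xl).
congr (_ + _).
  rewrite big_distrr /= [RHS](reindex_onto (fun E => x |: E) (fun E => E :\ x)) /=; last first.
    by move=> E /andP[_ xE']; rewrite setD1K.
  apply: eq_big => [E|E El].
    rewrite setU11 andbT; apply/idP/andP => [El|[El /eqP xEE]].
      split; last by rewrite setU1K // xE.
      apply/subsetP => y; rewrite !inE => /orP[->//|yE].
      by have := subsetP El y yE; rewrite inE => ->; rewrite orbT.
    apply/subsetP => y yE; have : y \in (x |: E) :\ x by rewrite xEE.
    rewrite !inE => /andP[yx _]; have := subsetP El y.
    by rewrite !inE (negPf yx) yE; apply.
  rewrite mulrA big_cons setU11; congr (_ * _ * _).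
  apply: eq_big_seq => y yl; rewrite !inE.
  by have /negPf-> : y != x by apply: contraNneq xl => <-.
rewrite big_distrr /=; apply: eq_big => [E|E El].
  apply/idP/andP => [El|[El xE']].
    split; last exact: xE.
    by apply: subset_trans El _; apply/subsetP => y; rewrite !inE => ->; rewrite orbT.
  apply/subsetP => y yE; have := subsetP El y yE; rewrite !inE => /orP[/eqP yx|//].
  by rewrite -yx yE in xE'.
by rewrite mulrA big_cons (negPf (xE _ El)).
Qed.

Lemma expect_cst l a : expect l (fun=> a) = a.
Proof. by elim: l => //= x l ->; ring. Qed.

Lemma expect_sum (I : Type) (r : seq I) (P : pred I) l (f : I -> {set X} -> K) :
  expect l (fun E => \sum_(i <- r | P i) f i E) = \sum_(i <- r | P i) expect l (f i).
Proof.
elim: l f => [|x l IH] f //=; rewrite !IH !big_distrr -big_split /=.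
by apply: eq_bigr => i _.
Qed.

Lemma expectD l f g : expect l (fun E => f E + g E) = expect l f + expect l g.
Proof. by elim: l f g => //= x l IH f g; rewrite !IH; ring. Qed.

Lemma expect_avoid l (Q : {set X}) :
  expect l (fun E => [disjoint E & Q]%:R) = (1 - p) ^+ count (mem Q) l.
Proof.
have dU x E : [disjoint x |: E & Q] = (x \notin Q) && [disjoint E & Q].
  by rewrite -disjointU1; apply: eq_disjoint => y; rewrite !inE.
elim: l => [|x l IH] /=.
  by rewrite eq_disjoint0 // => x; rewrite inE.
have [xQ|xQ] := boolP (x \in Q).
  rewrite (@eq_expect _ _ (fun=> 0)) => [|E]; last by rewrite dU xQ.
  by rewrite expect_cst mulr0 add0r IH exprS.
rewrite (@eq_expect _ _ (fun E => [disjoint E & Q]%:R)) => [|E].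
  by rewrite IH add0n; ring.
by rewrite dU xQ.
Qed.

(** Distinct colours are hit by disjoint sets of elements, hence independently. In the induction,
    selecting [x] removes the colour of [x] from the requirements. *)
Lemma expect_hit l (C : finType) (col : X -> C) (B : {set C}) :
  expect l (fun E => [forall c in B, [exists x in E, col x == c]]%:R) =
  \prod_(c in B) (1 - (1 - p) ^+ count (fun x => col x == c) l).
Proof.
elim: l B => [|x l IH] B /=.
  have [->|[c cB]] := set_0Vmem B.
    by rewrite big_set0; case: forall_inP => // -[] c; rewrite inE.
  rewrite (bigD1 c) //= expr0 subrr mul0r.
  case: forall_inP => // /(_ _ cB) /exists_inP[x]; rewrite inE.
  by [].
rewrite IH.
have [xB|xB] := boolP (col x \in B); last first.
  rewrite (@eq_expect _ _
     (fun E => [forall c in B, [exists x in E, col x == c]]%:R)) => [|E].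
    rewrite IH -mulrDl addrC subrK mul1r; apply: eq_bigr => c cB.
    by have /negPf-> : col x != c by apply: contraNneq xB => ->.
  congr (nat_of_bool _)%:R; apply: eq_forallb => c; case: (boolP (c \in B)) => //= cB.
  apply/exists_inP/exists_inP => [[y]|[y yE yc]]; last by exists y; rewrite // inE yE orbT.
  rewrite !inE => /orP[/eqP->|yE yc]; last by exists y.
  by move=> /eqP xc; rewrite xc cB in xB.
rewrite (@eq_expect _ _
     (fun E => [forall c in B :\ col x, [exists x in E, col x == c]]%:R)) => [|E].
  rewrite !IH [X in _ + _ * X](bigD1 (col x)) //= [RHS](bigD1 (col x)) //= eqxx exprS.
  rewrite (eq_bigl (fun c => (c \in B) && (c != col x))); last first.
    by move=> c; rewrite !inE andbC.
  set Y := \prod_(c in B | _) _.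
  have -> : \prod_(c in B | c != col x)
      (1 - (1 - p) ^+ ((col x == c) + count (fun y => col y == c) l)) = Y.
    by apply: eq_bigr => c /andP[_]; rewrite eq_sym => /negPf->.
  ring.
congr (nat_of_bool _)%:R; apply/forall_inP/forall_inP => H c.
  rewrite !inE => /andP[cx cB]; have /exists_inP[y] := H c cB.
  rewrite !inE => /orP[/eqP->|yE yc]; last by apply/exists_inP; exists y.
  by rewrite eq_sym (negPf cx).
move=> cB; apply/exists_inP; have [<-|cx] := eqVneq (col x) c.
  by exists x; rewrite ?setU11.
have cB' : c \in B :\ col x by rewrite !inE eq_sym cx.
by have /exists_inP[y yE yc] := H c cB'; exists y; rewrite // inE yE orbT.
Qed.

Hypothesis p01 : 0 <= p <= 1.

Lemma ler_expect l f g :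
  (forall E : {set X}, E \subset [set x in l] -> f E <= g E) -> expect l f <= expect l g.
Proof.
have /andP[p0 p1] := p01.
elim: l f g => [|x l IH] f g fg /=; first by apply: fg; rewrite sub0set.
apply: lerD; apply: ler_wpM2l; rewrite ?subr_ge0 //; apply: IH => E El; apply: fg.
  apply/subsetP => y; rewrite !inE => /orP[->//|yE].
  by have := subsetP El y yE; rewrite inE => ->; rewrite orbT.
by apply: subset_trans El _; apply/subsetP => y; rewrite !inE => ->; rewrite orbT.
Qed.

End RandomSubset.

(** * Vertex exposure and greedy colouring *)

Section VertexExposure.
Variable n : nat.
Implicit Types (E : {set 'I_n * 'I_n}) (m : nat).

Definition star m : seq ('I_n * 'I_n) := [seq e : 'I_n * 'I_n <- enum (pairs n) | e.2 == m :> nat].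

Fixpoint pairs_below m : seq ('I_n * 'I_n) :=
  if m is m'.+1 then pairs_below m' ++ star m' else [::].

Lemma mem_star m e : (e \in star m) = vert_pair e && (e.2 == m :> nat).
Proof. by rewrite mem_filter mem_enum inE andbC. Qed.

Lemma mem_pairs_below m e : (e \in pairs_below m) = vert_pair e && (e.2 < m).
Proof.
elim: m => [|m IH]; first by rewrite in_nil ltn0 andbF.
by rewrite mem_cat IH mem_star -andb_orr ltnS [in RHS]leq_eqVlt orbC.
Qed.

Lemma uniq_star m : uniq (star m).
Proof. exact: filter_uniq (enum_uniq _). Qed.

Lemma uniq_pairs_below m : uniq (pairs_below m).
Proof.
elim: m => [|m IH] //=; rewrite cat_uniq IH uniq_star //= andbT.
apply/hasPn => e; rewrite mem_star mem_pairs_below => /andP[_ /eqP->].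
by rewrite ltnn andbF.
Qed.

Lemma pairs_below_all : [set e in pairs_below n] = pairs n.
Proof. by apply/setP => e; rewrite !inE mem_pairs_below ltn_ord andbT. Qed.

Lemma size_star m : size (star m) <= n.
Proof.
have u : uniq [seq e.1 | e <- star m].
  rewrite map_inj_in_uniq ?uniq_star // => -[i j] [i' j'].
  rewrite !mem_star /= => /andP[_ /eqP jm] /andP[_ /eqP jm'] ->.
  by congr (_, _); apply: val_inj; rewrite /= jm jm'.
by rewrite -[leqRHS]card_ord -(size_map fst) -(card_uniqP u) max_card.
Qed.

Definition colourable k E :=
  [exists chi : {ffun 'I_n -> 'I_k}, [forall e in E, chi e.1 != chi e.2]].

(** If the new vertex [m] missed a colour [c] among its neighbours, giving it colour [c] would
    extend [chi]. *)
Lemma extend_colouring k m (E1 E2 : {set 'I_n * 'I_n}) (chi : {ffun 'I_n -> 'I_k}) :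
  E1 \subset [set e in pairs_below m] -> E2 \subset [set e in star m] ->
  [forall e in E1, chi e.1 != chi e.2] -> ~~ colourable k (E1 :|: E2) ->
  [forall c in [set: 'I_k], [exists e in E2, chi e.1 == c]].
Proof.
move=> E1m E2m /forall_inP chiE ncol; apply/forall_inP => c _.
apply: contraNT ncol => /exists_inPn cE2.
apply/existsP; exists [ffun i : 'I_n => if i == m :> nat then c else chi i].
apply/forall_inP => e; rewrite !ffunE in_setU => /orP[eE|eE].
  have := subsetP E1m e eE; rewrite inE mem_pairs_below => /andP[e12 e2m].
  have e1m := ltn_trans e12 e2m.
  by rewrite (ltn_eqF e1m) (ltn_eqF e2m) chiE.
have := subsetP E2m e eE; rewrite inE mem_star => /andP[e12 /eqP e2m].
by rewrite e2m eqxx (ltn_eqF (_ : e.1 < m)) -?e2m //; apply: cE2.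
Qed.

Variables (K : realFieldType) (p : K).
Hypothesis p01 : (0 <= p <= 1)%R.
Local Open Scope ring_scope.

(** Each new vertex adds at most [delta] to the failure probability. Given a colouring of the
    revealed graph, failure forces the new star to hit every colour, and [a c] counts the pairs of
    the star whose smaller endpoint has colour [c]. *)
Lemma expect_not_colourable k (delta : K) m : 0 <= delta ->
  (forall a : 'I_k -> nat, (\sum_c a c <= n)%N ->
     \prod_c (1 - (1 - p) ^+ a c) <= delta) ->
  (forall i : 'I_n, (0 < k)%N) ->
  expect p (pairs_below m) (fun E => (~~ colourable k E)%:R) <= delta *+ m.
Proof.
move=> delta0 deltaP k0; elim: m => [|m IH] /=.
  rewrite (_ : colourable _ _) //; apply/existsP.
  exists [ffun i => Ordinal (k0 i)]; apply/forall_inP => e; by rewrite inE.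
rewrite expect_cat mulrSr.
apply: le_trans (lerD IH (lexx delta)).
rewrite -[X in _ <= _ + X](expect_cst p (pairs_below m)) -expectD.
apply: ler_expect => // E1 E1m.
have [/existsP[chi chiE]|ncol] := boolP (colourable k E1); last first.
  apply: (@le_trans _ _ 1); last by rewrite lerDl.
  rewrite -[leRHS](expect_cst p (star m)); apply: ler_expect => // E2 _.
  by rewrite lern1 leq_b1.
rewrite add0r.
have sum_le : (\sum_(c : 'I_k) count (fun e : 'I_n * 'I_n => chi e.1 == c) (star m) <= n)%N.
  apply: leq_trans (size_star m); rewrite -count_predT -sum1_count.
  rewrite (partition_big (fun e => chi e.1) predT) //=.
  by apply: leq_sum => c _; rewrite -sum1_count.
apply: le_trans (deltaP _ sum_le).
have := expect_hit p (star m) (fun e : 'I_n * 'I_n => chi e.1) setT.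
under [X in _ = X -> _]eq_bigl do rewrite inE.
move=> <-; apply: ler_expect => // E2 E2m.
rewrite ler_nat; case: (boolP (colourable k _)) => // ncol.
by rewrite (extend_colouring E1m E2m chiE ncol).
Qed.

(** Folds a set of ordered pairs into the potential edges it covers, each stored with its smaller
    endpoint first. *)
Definition crossing (S : {set 'I_n * 'I_n}) : {set 'I_n * 'I_n} :=
  [set e | vert_pair e & (e \in S) || ((e.2, e.1) \in S)].

(** A potential edge accounts for at most two ordered pairs of [S]; only the diagonal is left
    over. *)
Lemma card_crossing (S : {set 'I_n * 'I_n}) :
  (#|S| <= 2 * #|crossing S| + #|[set i | (i, i) \in S]|)%N.
Proof.
pose sw (e : 'I_n * 'I_n) := (e.2, e.1).
have sub : S \subset (crossing S :|: sw @: crossing S)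
             :|: (fun i => (i, i)) @: [set i | (i, i) \in S].
  apply/subsetP => -[i j] ijS; rewrite !inE /vert_pair /= ijS.
  case: (ltngtP i j) => [//|ji|ij] /=.
    apply/orP; left; apply/imsetP; exists (j, i) => //.
    by rewrite inE /vert_pair /= ji ijS orbT.
  apply/orP; right; apply/imsetP; exists i; last by congr (_, _); apply/val_inj.
  by rewrite inE; have -> : (i, i) = (i, j) by congr (_, _); apply/val_inj.
apply: leq_trans (subset_leq_card sub) _.
apply: leq_trans (leq_card_setU _ _) _; apply: leq_add; last exact: leq_imset_card.
apply: leq_trans (leq_card_setU _ _) _; rewrite mul2n -addnn leq_add2l.
exact: leq_imset_card.
Qed.

Lemma expect_disjoint_crossing (S : {set 'I_n * 'I_n}) :
  expect p (pairs_below n) (fun E => [disjoint E & crossing S]%:R)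
  = (1 - p) ^+ #|crossing S|.
Proof.
rewrite expect_avoid; congr (_ ^+ _).
rewrite -size_filter -(card_uniqP (filter_uniq _ (uniq_pairs_below n))).
apply: eq_card => e; rewrite mem_filter mem_pairs_below ltn_ord andbT.
by rewrite !inE; case: (vert_pair e); rewrite ?andbT ?andbF.
Qed.

End VertexExposure.

(** * Union bound over sparse patterns *)

Section SparsePatterns.
Variables (K : realFieldType) (n : nat).
Local Open Scope ring_scope.

Definition sparse_witness (rho : K) (TS : {set 'I_n * 'I_n} * {set 'I_n * 'I_n}) :=
  [&& TS.1 != set0, TS.2 \in realisable K TS.1,
      (#|[set i | (i, i) \in TS.2]| <= #|TS.1|)%N
    & n%:R * #|TS.1|%:R <= rho * #|TS.2|%:R].

Definition avoids_sparse_pattern rho (E : {set 'I_n * 'I_n}) :=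
  [exists TS, sparse_witness rho TS && [disjoint E & crossing TS.2]].

Lemma exprD1_le (y : K) N : 0 <= y -> (2 * N)%:R * y <= 1 ->
  (1 + y) ^+ N <= 1 + (2 * N)%:R * y.
Proof.
move=> y0; elim: N => [|N IH] Ny; first by rewrite expr0 muln0 mul0r addr0.
have Ny' : (2 * N)%:R * y <= 1.
  by apply: le_trans Ny; rewrite ler_wpM2r // ler_nat leq_mul2l leqnSn orbT.
rewrite exprSr.
apply: le_trans (ler_wpM2r _ (IH Ny')) _; first by rewrite addr_ge0.
rewrite mulnS natrD; set a := (2 * N)%:R in Ny' *.
have : a * y * y <= 1 * y by apply: ler_wpM2r.
by lra.
Qed.

Lemma sum_subsets_expr (X : finType) (y : K) :
  \sum_(T : {set X}) y ^+ #|T| = (1 + y) ^+ #|X|.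
Proof.
rewrite -[in RHS]cardsT -prodr_const [RHS]big_mkcond /=.
transitivity (\prod_(i : X) (y + 1)); last by apply: eq_bigr => i _; rewrite inE addrC.
rewrite bigA_distr; apply: eq_bigr => T _.
by rewrite -big_mkcond /= prodr_const.
Qed.

(** Each [T] carries at most [n ^ (4 * #|T|)] patterns, each avoided with probability at most
    [z ^ #|T|]. With [y = n ^ 4 * z], summing over nonempty [T] gives
    [(1 + y) ^ (n ^ 2) - 1 <= 2 * n ^ 2 * y]. *)
Lemma expect_avoids_sparse_pattern (p rho z : K) :
  0 <= p <= 1 -> 0 <= z -> (1 < n)%N ->
  (forall TS, sparse_witness rho TS ->
     (1 - p) ^+ #|crossing TS.2| <= z ^+ #|TS.1|) ->
  (2 * n ^ 6)%:R * z <= 1 ->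
  expect p (pairs_below n n) (fun E => (avoids_sparse_pattern rho E)%:R)
  <= (2 * n ^ 6)%:R * z.
Proof.
move=> p01 z0 n1 wz zsmall.
pose y := (n ^ 4)%:R * z.
have y0 : 0 <= y by rewrite mulr_ge0.
have e6 : (2 * n ^ 6)%:R * z = (2 * (n * n))%:R * y.
  by rewrite /y mulrA -natrM -mulnA -mulnA mulnA -!expnS.
apply: (@le_trans _ _ (expect p (pairs_below n n)
    (fun E => \sum_(TS | sparse_witness rho TS) [disjoint E & crossing TS.2]%:R))).
  apply: ler_expect => // E _.
  case: (boolP (avoids_sparse_pattern rho E)) => [/existsP[TS /andP[w dis]]|_].
    by rewrite (bigD1 TS) //= dis lerDl sumr_ge0.
  by rewrite sumr_ge0.
rewrite expect_sum.
apply: (@le_trans _ _ (\sum_(TS | sparse_witness rho TS) z ^+ #|TS.1|)).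
  by apply: ler_sum => TS w; rewrite expect_disjoint_crossing wz.
apply: (@le_trans _ _ (\sum_(T : {set 'I_n * 'I_n} | T != set0)
    \sum_(S in realisable K T) z ^+ #|T|)).
  rewrite pair_big_dep /= [leRHS]big_mkcond [leLHS]big_mkcond /=.
  apply: ler_sum => TS _; case: ifP => [/and4P[-> -> _ _] //|_].
  by case: ifP; rewrite ?exprn_ge0.
apply: (@le_trans _ _ (\sum_(T : {set 'I_n * 'I_n} | T != set0) y ^+ #|T|)).
  apply: ler_sum => T _; rewrite sumr_const -mulr_natl exprMn -natrX -expnM.
  by rewrite ler_wpM2r ?exprn_ge0 // ler_nat card_realisable.
have := sum_subsets_expr ('I_n * 'I_n)%type y.
rewrite (bigD1 set0) //= cards0 expr0 card_prod card_ord => sumE.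
rewrite -(lerD2l 1) sumE e6; apply: exprD1_le => //.
by rewrite -e6.
Qed.
End SparsePatterns.

(** * Unit distance representations *)

Section UnitDistanceGraphs.
Variable n : nat.
Local Open Scope ring_scope.
Implicit Types E : {set 'I_n * 'I_n}.

Lemma sqdistE d (x y : 'I_d -> R) : sqdist x y = \sum_k (x k - y k) ^+ 2.
Proof. by apply: eq_bigr => k _; rewrite RpowE. Qed.

(** A negative [x] is excluded because its [sqrt] is 0 by convention. *)
Lemma sqrt_eq1 (x : R) : sqrt x = 1 -> x = 1.
Proof.
move=> sx; have [x0|x0] := Rle_or_lt 0 x.
  by rewrite -(sqrt_sqrt x x0) sx; exact: mulr1.
by move: sx; rewrite sqrt_neg_0; [move/eqP; rewrite eq_sym oner_eq0 | apply: Rlt_le].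
Qed.

(** Expanding the squared distance writes [M] as twice a Gram matrix of rank at most [d] plus two
    matrices of rank at most 1. *)
Lemma unit_distance_matrix d E : unit_distance_graph d E ->
  exists M : 'M[R]_n, [/\ M^T = M, forall i, M i i = 1, (\rank M <= d + 2)%N
    & forall i j, adj E i j -> M i j = 0].
Proof.
move=> [u uE].
pose V : 'M[R]_(n, d) := \matrix_(i, k) u i k.
pose a : 'cV[R]_n := \col_i (1 - \sum_k u i k ^+ 2).
pose b : 'rV[R]_n := \row_j (- \sum_k u j k ^+ 2).
pose M : 'M[R]_n := \matrix_(i, j) (1 - sqdist (u i) (u j)).
have ME : M = 2 *: (V *m V^T) + (a *m const_mx 1 + const_mx 1 *m b).
  apply/matrixP => i j; rewrite !mxE !big_ord1 !mxE mulr1 mul1r sqdistE.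
  under eq_bigr do rewrite sqrrB.
  rewrite big_split sumrB /=.
  under [X in _ = 2 * X + _]eq_bigr do rewrite !mxE.
  by rewrite sumrMnl; ring.
exists M; split.
- apply/matrixP => i j; rewrite !mxE !sqdistE; congr (_ - _).
  by apply: eq_bigr => k _; rewrite -opprB sqrrN.
- by move=> i; rewrite mxE sqdistE big1 ?subr0 // => k _; rewrite subrr expr0n.
- rewrite ME; apply: leq_trans (mxrank_add _ _) _; apply: leq_add.
    apply: leq_trans (mxrank_scale _ _) _.
    by apply: leq_trans (mxrankM_maxl _ _) _; exact: rank_leq_col.
  apply: leq_trans (mxrank_add _ _) _; apply: (@leq_add _ _ 1 1).
    by apply: leq_trans (mxrankM_maxl _ _) _; exact: rank_leq_col.
  by apply: leq_trans (mxrankM_maxl _ _) _; exact: rank_leq_col.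
by move=> i j /uE /sqrt_eq1 ij; rewrite mxE ij subrr.
Qed.

(** The pattern [S] lies in the support of [M], while [M] vanishes at every edge in both
    orientations, so no edge is covered by [S]. *)
Lemma unit_distance_sparse_pattern (rho : R) d E : (0 < n)%N ->
  unit_distance_graph d E -> (d + 2)%:R <= rho -> avoids_sparse_pattern rho E.
Proof.
move=> n0 /unit_distance_matrix[M [Msym Mdiag Mrank Madj]] drho.
have Mdiag' i : M i i != 0 by rewrite Mdiag oner_eq0.
have [T [S [T0 ST Sdiag TS SM]]] := sparse_realisable_pattern n0 Msym Mdiag'.
apply/existsP; exists (T, S); rewrite /sparse_witness /= T0 ST Sdiag /=.
apply/andP; split.
  rewrite -natrM; apply: (@le_trans _ _ (\rank M * #|S|)%:R); first by rewrite ler_nat.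
  by rewrite natrM ler_wpM2r // (le_trans _ drho) // ler_nat.
rewrite disjoint_subset; apply/subsetP => e eE; rewrite inE /=.
apply/negP; rewrite inE => /andP[_ /orP[/SM|/SM]] /=;
  by rewrite Madj ?eqxx // /adj -surjective_pairing eE ?orbT.
Qed.

Lemma colourable_unit_distance k E : colourable k E -> unit_distance_graph k E.
Proof.
case/existsP => chi /forall_inP chiE.
have chi_adj i j : adj E i j -> chi i != chi j.
  by case/orP => /chiE //=; rewrite eq_sym.
(* Colour [c] is placed at the [c]-th unit vector divided by the square root of 2, so that distinct
   colours are at distance 1. *)
exists (fun i c => if c == chi i then Num.sqrt 2^-1 else 0) => i j /chi_adj ij.
set s := sqdist _ _; suff -> : s = 1 by rewrite sqrt_1.
rewrite /s sqdistE (bigD1 (chi i)) //= (bigD1 (chi j)) /=; last by rewrite eq_sym.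
rewrite !eqxx (negPf ij) eq_sym (negPf ij) big1 => [|c /andP[/negPf-> /negPf->]].
  by rewrite subr0 sub0r sqrrN sqr_sqrtr ?invr_ge0 //; lra.
by rewrite subrr expr0n.
Qed.

Lemma prob_gnpE (p : R) (A : {set 'I_n * 'I_n} -> Prop) :
  prob_gnp n p A = expect p (pairs_below n n) (fun E => indicator (A E)).
Proof.
rewrite expect_sumE ?uniq_pairs_below // pairs_below_all.
apply: eq_bigr => E _; rewrite /gnp_weight; congr (Rmult _ _).
rewrite big_uniq ?uniq_pairs_below //=.
by apply: eq_bigl => e; rewrite mem_pairs_below ltn_ord andbT.
Qed.

End UnitDistanceGraphs.

Delimit Scope R_scope with coqR.

(** * Both bounds hold with high probability *)

Section ThresholdEvent.
Local Open Scope ring_scope.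
Local Arguments exp _%_ring_scope.

Lemma exp_ge1D (y : R) : 1 + y <= exp y.
Proof. exact/RleP/exp_ineq1_le. Qed.

(* Convexity of [fun a => exp (- b * a)], in the form of the tangent at the mean. *)
Lemma prod_hit_le (k n : nat) (b : R) (a : 'I_k -> nat) :
  0 <= b -> (0 < k)%N -> (\sum_c a c <= n)%N ->
  \prod_c (1 - exp (- b) ^+ a c) <= exp (- (k%:R * exp (- (b * n%:R / k%:R)))).
Proof.
move=> b0 k0 an.
set e := exp (- (b * n%:R / k%:R)).
have kR : (0 : R) < k%:R by rewrite ltr0n.
have q0 : 0 <= exp (- b) by apply/RleP/Rlt_le/exp_pos.
have q1 : exp (- b) <= 1.
  by rewrite -expR0; apply/RleP/exp_le_mono/RleP; rewrite oppr_le0.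
have prod_exp : \prod_c exp (- exp (- b) ^+ a c) = exp (- \sum_(c < k) exp (- b) ^+ a c).
  rewrite -sumrN; symmetry; apply: (big_morph exp _ expR0) => u v.
  by rewrite expRD.
apply: (@le_trans _ _ (\prod_c exp (- exp (- b) ^+ a c))).
  apply: ler_prod => c _; rewrite subr_ge0 exprn_ile1 //=.
  exact: exp_ge1D.
rewrite prod_exp; apply/RleP/exp_le_mono/RleP; rewrite lerN2.
(* Here [e] is the value at [n / k]. As the [a c] sum to at most [n], the linear terms add up to
   something nonnegative, leaving at least [k * e]. *)
have tangent c : e * (1 - b * ((a c)%:R - n%:R / k%:R)) <= exp (- b) ^+ a c.
  have -> : exp (- b) ^+ a c = e * exp (- (b * ((a c)%:R - n%:R / k%:R))).
    rewrite expRX expRD; congr exp.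
    by rewrite -[- b *+ a c]mulr_natr ?RplusE ?RoppE; ring.
  by apply: ler_wpM2l; [apply/RleP/Rlt_le/exp_pos | exact: exp_ge1D].
apply: le_trans (ler_sum _ (fun c _ => tangent c)).
rewrite -mulr_sumr sumrB sumr_const card_ord -mulr_sumr sumrB sumr_const card_ord.
rewrite mulrC; apply: ler_wpM2l; first by apply/RleP/Rlt_le/exp_pos.
rewrite lerDl oppr_ge0 -[(n%:R / k%:R) *+ k]mulr_natr divfK ?gt_eqF //.
by rewrite mulr_ge0_le0 // subr_le0 -natr_sum ler_nat.
Qed.

Definition good_dimension (n : nat) (y : R) (E : {set 'I_n * 'I_n}) :=
  exists d : nat, is_min_unit_dim E d /\ (/ 80 * y <= INR d <= 400 * y)%coqR.

(** The colouring gives [d <= k]. If [d < y / 80], then [d + 2] would be at most [y / 80 + 2] and a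
    sparse pattern would be avoided. *)
Lemma good_dimension_of_colouring n k (y : R) (E : {set 'I_n * 'I_n}) :
  (0 < n)%N -> (INR k <= 400 * y)%coqR -> colourable k E ->
  ~~ avoids_sparse_pattern (y / 80 + 2)%coqR E -> good_dimension y E.
Proof.
move=> n0 ky /colourable_unit_distance kE nav.
have ex : exists d, `[< unit_distance_graph d E >] by exists k; apply/asboolP.
case: (ex_minnP ex) => d /asboolP dE dmin.
have dk : (INR d <= INR k)%coqR.
  by apply/le_INR/ssrnat.leP/dmin/asboolP.
exists d; split; first by split => // d' d'E; apply: dmin; apply/asboolP.
split; last by Lra.lra.
apply: Rnot_lt_le => dy; case/negP: nav.
apply: (unit_distance_sparse_pattern n0 dE).
by rewrite -INRE; apply/RleP; rewrite plus_INR /=; Lra.lra.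
Qed.

Lemma indicator_ge0 P : (0 <= indicator P)%coqR.
Proof.
by rewrite /indicator; case: (ClassicalEpsilon.excluded_middle_informative P) => H /=; Lra.lra.
Qed.

Lemma indicator_le1 P : (indicator P <= 1)%coqR.
Proof.
by rewrite /indicator; case: (ClassicalEpsilon.excluded_middle_informative P) => H /=; Lra.lra.
Qed.

Lemma indicator_true (P : Prop) : P -> indicator P = 1.
Proof.
by rewrite /indicator; case: (ClassicalEpsilon.excluded_middle_informative P).
Qed.

(** Outside two failure events, each of probability at most [1 / n], the dimension is good; [3 / n]
    leaves some slack. *)
Lemma prob_good_dimension (n : nat) (p : R) :
  (exp 64000%coqR <= INR n)%coqR -> (Rpower (INR n) (- (99 / 100)) <= p)%coqR ->
  (p <= 1 - / INR n)%coqR ->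
  (1 - 3 / INR n <=
    prob_gnp n p (good_dimension (INR n * ln (/ (1 - p)) / ln (INR n))) <= 1)%coqR.
Proof.
move=> nl pl ph.
have [/RltP/ltW p0 /RltP/ltW p1] := p_bounds nl pl ph.
have p01 : 0 <= p <= 1 by rewrite p0.
have nR := INR_large nl.
have expb := exp_neg_log nl pl ph.
have xl := ratio_large nl pl ph.
have b0 : (0 <= ln (/ (1 - p)))%coqR.
  by have := log_ge_p nl pl ph; move/RleP: p0 => p0'; have := p_bounds nl pl ph; Lra.lra.
set b := ln (/ (1 - p))%coqR in expb xl b0 *.
set y := (INR n * b / ln (INR n))%coqR in xl *.
have n1 : (1 < n)%N by apply/ssrnat.ltP/INR_lt => /=; Lra.lra.
(* The number of colours must be at least [200 y] for the greedy bound, and rounding to an integer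
   within a factor 2 yields the constant 400. *)
have [k [ky1 ky2]] : exists k : nat, (200 * y <= INR k <= 2 * (200 * y))%coqR.
  by apply: exists_nat_between; Lra.lra.
have k0 : (0 < k)%N by apply/ssrnat.ltP/INR_lt => /=; Lra.lra.
have small := greedy_failure_small nl pl ph ky1.
rewrite -/b in small.
set delta := exp (- (k%:R * exp (- (b * n%:R / k%:R)))).
have delta0 : 0 <= delta by apply/RleP/Rlt_le/exp_pos.
have ndelta : delta *+ n <= (INR n)^-1.
  rewrite -mulr_natl -INRE /delta -!INRE; exact/RleP.
have ncol : expect p (pairs_below n n) (fun E => (~~ colourable k E)%:R) <= (INR n)^-1.
  apply: le_trans ndelta; apply: expect_not_colourable => // a an.
  have -> : 1 - p = exp (- b) by rewrite expb.
  by apply: prod_hit_le => //; apply/RleP.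
pose rho := (y / 80 + 2)%coqR.
have npos : (0 < / INR n)%coqR by apply: Rinv_0_lt_compat; Lra.lra.
(* The union bound is applied with [z = n ^ (-10)], the saving per element of [T] given by
   [avoid_prob_small]. *)
have zsmall : (2 * n ^ 6)%:R * (INR n)^-1 ^+ 10 <= (INR n)^-1.
  rewrite natrM natrX -!INRE; apply/RleP.
  rewrite -!RpowE -!RmultE -!RinvE (_ : INR 2 = 2%coqR) //.
  exact: sparse_failure_small nl.
have av : expect p (pairs_below n n) (fun E => (avoids_sparse_pattern rho E)%:R)
          <= (INR n)^-1.
  apply: le_trans (zsmall); apply: expect_avoids_sparse_pattern => //.
  - by rewrite exprn_ge0 //; apply/RleP/Rlt_le.
  - move=> [T S] /= /and4P[/= T0 _ Sdiag]; rewrite -!INRE => /RleP wTS.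
    have -> : 1 - p = exp (- b) by rewrite expb.
    apply/RleP; rewrite -!RpowE.
    apply: (avoid_prob_small nl pl ph _ wTS).
      by apply: (le_INR 1); apply/ssrnat.leP; rewrite card_gt0.
    have := leq_trans (card_crossing S) (leq_add (leqnn _) Sdiag).
    by move/ssrnat.leP/le_INR; rewrite plus_INR mult_INR.
  - apply: le_trans zsmall _; apply/RleP.
    by rewrite -R1E -Rinv_1; apply: Rinv_le_contravar; Lra.lra.
rewrite prob_gnpE; split.
  set P := expect _ _ _.
  (* Pointwise, the indicators of a good dimension, of non-colourability and of avoiding a sparse
     pattern sum to at least 1; taking expectations gives the bound. *)
  have : 1 <= P + (INR n)^-1 + (INR n)^-1.
    apply: le_trans (lerD (lerD (lexx P) ncol) av).
    rewrite -[leLHS](expect_cst p (pairs_below n n)) -!expectD.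
    apply: ler_expect => // E _.
    have [col|_] := boolP (colourable k E); last first.
      rewrite addrAC lerDr addr_ge0 //; apply/RleP; exact: indicator_ge0.
    have [nav|nav] := boolP (avoids_sparse_pattern rho E).
      by rewrite addr0 lerDr; apply/RleP; exact: indicator_ge0.
    rewrite !addr0 indicator_true //.
    apply: (good_dimension_of_colouring _ _ col nav); first exact: ltnW.
    by rewrite -/b -/y; Lra.lra.
  move/RleP; rewrite -!RplusE -RinvE; move: npos; rewrite /Rdiv.
  by set v := (/ INR n)%coqR; rewrite -R1E => *; Lra.lra.
apply/RleP; rewrite -[leRHS](expect_cst p (pairs_below n n)).
by apply: ler_expect => // E _; apply/RleP; exact: indicator_le1.
Qed.
End ThresholdEvent.

Delimit Scope R_scope with R.

Theorem theorem4p2 :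
  exists c C : R, (0 < c)%R /\ (c < C)%R /\
  forall p : nat -> R,
    (exists n0 : nat, forall n : nat, (n0 <= n)%N ->
       (Rpower (INR n) (- (99 / 100)) <= p n <= 1 - / INR n)%R) ->
    Un_cv
      (fun n : nat =>
         prob_gnp n (p n)
           (fun E => exists d : nat, is_min_unit_dim E d /\
              (c * (INR n * ln (/ (1 - p n)) / ln (INR n)) <= INR d
               <= C * (INR n * ln (/ (1 - p n)) / ln (INR n)))%R))
      1%R.
Proof.
exists (/ 80)%R, 400%R; split; first by Lra.lra.
split; first by Lra.lra.
move=> p [n0 hp] eps eps0.
(* Beyond this value [n] is large enough for all estimates and the error [3 / n] is below [eps]. *)
destruct (archimed (exp 64000 + 3 / eps)) as [hN _].
exists (maxn n0 (Z.to_nat (up (exp 64000 + 3 / eps)))) => n /ssrnat.leP.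
rewrite geq_max => /andP[/hp [pl ph] /ssrnat.leP/le_INR Nn].
have e0 := exp_pos 64000.
have q0 : (0 < 3 / eps)%R by apply: Rdiv_lt_0_compat; Lra.lra.
have nbig : (exp 64000 + 3 / eps < INR n)%R.
  apply: Rlt_le_trans Nn; rewrite INR_IZR_INZ Z2Nat.id //.
  by apply: le_IZR; Lra.lra.
have nl : (exp 64000 <= INR n)%R by Lra.lra.
have [lo hi] := prob_good_dimension nl pl ph.
have n_eps : (3 / INR n < eps)%R by apply: Rdiv_lt_swap; Lra.lra.
by apply: Rabs_def1; rewrite /good_dimension in lo hi; Lra.lra.
Qed.
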